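(* Let $n\ge1$ and $k\in\{1,\dots,n\}$, and write the coordinates on $\mathbb{C}^n$ as $\zeta=(z,w)$ with $z=x+iy\in\mathbb{C}^k$, $w=u+iv\in\mathbb{C}^{n-k}$. Let $A$ and $B$ be real symmetric matrices of dimension $k$ and $n-k$ respectively, with $A-I$ and $B$ positive definite, and set $$Q(y,w)=\langle Ay,y\rangle+\langle Bv,v\rangle+|u|^2,\qquad \rho(z,w)=Q(y,w)-|x|^2,\qquad \Lambda^k=\{(x+i0,0)\in\mathbb{C}^n:x\in\mathbb{R}^k\}.$$ Let $r>0$, $\epsilon>0$, and let $0<r<c_0<R$ and $\delta>0$ be constants and $h\colon[0,+\infty)\to[0,+\infty)$ a smooth, increasing, weakly convex function such that $\tau(z,w)=Q(y,w)-h(|x|^2)$ is a strongly plurisubharmonic function on $\mathbb{C}^n$ with a Morse critical point of index $k$ at $0$, satisfying (i) $\tau(z,w)=Q(y,w)-\delta|x|^2$ for $|x|^2\le r$; (ii) $\tau(z,w)=\rho(z,w)+c_0$ for $|x|^2\ge R$; (iii) $\{\rho\le-c_0\}\cup\Lambda^k\subset\{\tau\le0\}\subset\{\rho<-r\}\cup\{Q<\epsilon\}$. Then for every sufficiently small $c>0$ the set $K_c=\{\zeta\in\mathbb{C}^n:\tau(\zeta)\le c\}$ is a strongly pseudoconvex handlebody with center $$E_{c-c_0}=\{\zeta\in\mathbb{C}^n:\rho(\zeta)\le c-c_0\}\cup\Lambda^k,$$ satisfying $E_{c-c_0}\subset K_c\subset\{\rho<-r\}\cup\{Q<\epsilon\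}$.
   Context: $\langle\cdot,\cdot\rangle$ is the Euclidean inner product and $|\cdot|$ the Euclidean norm on any $\mathbb{R}^m$. A $C^2$ function $\phi$ on an open set $V\subset\mathbb{C}^n$ is strongly plurisubharmonic if its Levi form $\sum_{j,k=1}^n\frac{\partial^2\phi}{\partial\zeta_j\partial\bar\zeta_k}(\zeta)\,v_j\bar v_k$ is $>0$ for all $\zeta\in V$ and $v\in\mathbb{C}^n\setminus\{0\}$. A closed, smoothly bounded, strongly pseudoconvex domain is a set $K=\{\phi\le0\}$, where $\phi$ is a smooth strongly plurisubharmonic function in an open set containing $K$ with $d\phi\ne0$ on $bK=\{\phi=0\}$ ($K$ is not required to be compact). A strongly pseudoconvex handlebody with center $E$ is such a closed strongly pseudoconvex domain $K\supset E$ which admits a strong deformation retraction onto $E$. Sets such as $\{\rho<-r\}$, $\{Q<\epsilon\}$ denote sublevel sets in $\mathbb{C}^n$, with $Q$ regarded as a function of $(z,w)$. If $k=n$, the variable $w$ and the matrix $B$ are absent. (Data $c_0,R,\delta,h,\tau$ as in the hypothesis exist for all $r,\epsilon>0$.) *)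

(* Defs.v *)
From HB Require Import structures.
From mathcomp Require Import all_boot all_order all_algebra.
From mathcomp Require Import complex.
From mathcomp Require Import all_classical all_reals all_analysis.

Set Implicit Arguments.
Unset Strict Implicit.
Unset Printing Implicit Defensive.

Import Order.TTheory GRing.Theory Num.Theory.
Import numFieldNormedType.Exports.

Local Open Scope classical_set_scope.
Local Open Scope ring_scope.

(* C^n as a real normed space: zeta : Cn R n is the pair (Re zeta, Im zeta).
   The library's norm is a sup norm, so it is only used for the topology and
   the differential calculus; Euclidean quantities go through [dot]. *)
Notation Cn R n := ('rV[R]_n * 'rV[R]_n)%type.

Definition dot (R : realType) (n : nat) (a b : 'rV[R]_n) : R :=
  \sum_i a 0 i * b 0 i.

(* Vectors are rows, so the vector M a of the column convention is a *m M^T. *)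
Definition posdef (R : realType) (n : nat) (M : 'M[R]_n) : Prop :=
  forall a : 'rV[R]_n, a != 0 -> 0 < dot (a *m M^T) a.

(* Real-valued functions of class C^j on an open subset U of a
   finite-dimensional normed space: since V is finite-dimensional, continuity
   of the differential amounts to continuity of p |-> 'd f p v for each v. *)
Fixpoint Ck (R : realType) (V : normedModType R) (j : nat) (U : set V)
    (f : V -> R) : Prop :=
  match j with
  | 0 => forall p, U p -> {for p, continuous f}
  | j'.+1 => (forall p, U p -> differentiable f p) /\
             (forall v, Ck j' U ('D_v f))
  end.

Definition smooth (R : realType) (V : normedModType R) (U : set V)
  (f : V -> R) : Prop := forall j, Ck j U f.

(* Smoothness on the closed half-line is smoothness up to the endpoint 0. *)
Definition smooth_on_nonneg (R : realType) (h : R -> R) : Prop :=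
  exists2 g : R -> R, smooth (setT : set R^o) g & {in `[0, +oo[, h =1 g}.

Section Levi.
Variables (R : realType) (n : nat).
Implicit Types (p : Cn R n) (j : 'I_n).
Local Open Scope complex_scope.

Definition dir_re j : Cn R n := (delta_mx 0 j, 0).
Definition dir_im j : Cn R n := (0, delta_mx 0 j).

Definition cderive (f : Cn R n -> R[i]) (v p : Cn R n) : R[i] :=
  ('D_v (fun q => complex.Re (f q)) p) +i* ('D_v (fun q => complex.Im (f q)) p).

(* Wirtinger operators d/dzeta_j and d/dbar(zeta_j) *)
Definition dzeta j (f : Cn R n -> R[i]) p : R[i] :=
  2^-1 * (cderive f (dir_re j) p - 'i * cderive f (dir_im j) p).

Definition dzetabar j (f : Cn R n -> R[i]) p : R[i] :=
  2^-1 * (cderive f (dir_re j) p + 'i * cderive f (dir_im j) p).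

Definition levi (phi : Cn R n -> R) p (v : 'rV[R[i]]_n) : R[i] :=
  \sum_j \sum_l
    dzeta j (dzetabar l (fun q => (phi q)%:C)) p * v 0 j * conjc (v 0 l).

End Levi.

(* V is meant to be open. In R[i], 0 < z says that z is real and positive. *)
Definition strongly_psh (R : realType) (n : nat) (V : set (Cn R n))
    (phi : Cn R n -> R) : Prop :=
  Ck 2 V phi /\
  forall p, V p -> forall v : 'rV[R[i]]_n, v != 0 -> 0 < levi phi p v.

Section Morse.
Variables (R : realType) (n : nat).
Implicit Types (f : Cn R n -> R) (p : Cn R n) (W : {vspace Cn R n}).

Definition hessian f p (a b : Cn R n) : R := 'D_a ('D_b f) p.

Definition hessian_negdef_on f p W : Prop :=
  forall a, a \in W -> a != 0 -> hessian f p a a < 0.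

(* For f of class C^2 near p. The index is the maximal dimension of a real
   subspace on which the Hessian is negative definite. *)
Definition morse_critical_point f p (k : nat) : Prop :=
  [/\ differentiable f p,
      forall v, 'd f p v = 0,
      forall a, (forall b, hessian f p a b = 0) -> a = 0,
      exists2 W : {vspace Cn R n}, \dim W = k & hessian_negdef_on f p W &
      forall W : {vspace Cn R n}, hessian_negdef_on f p W -> (\dim W <= k)%N].

End Morse.

Definition frontier (T : topologicalType) (K : set T) : set T :=
  closure K `\` interior K.

Definition closed_spc_domain (R : realType) (n : nat) (K : set (Cn R n)) :
    Prop :=
  closed K /\
  exists (U : set (Cn R n)) (phi : Cn R n -> R),
    [/\ [/\ open U, K `<=` U, smooth U phi & strongly_psh U phi],
        K = [set p | U p /\ phi p <= 0],
        frontier K = [set p | U p /\ phi p = 0] &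
        forall p, frontier K p -> exists v, 'd phi p v != 0].

Definition strong_deformation_retract (R : realType) (T : topologicalType)
    (K E : set T) : Prop :=
  E `<=` K /\
  exists H : T * R -> T,
    [/\ {within K `*` `[0, 1]%classic, continuous H},
        forall p t, K p -> 0 <= t <= 1 -> K (H (p, t)),
        forall p, K p -> H (p, 0) = p,
        forall p, K p -> E (H (p, 1)) &
        forall p t, E p -> 0 <= t <= 1 -> H (p, t) = p].

Definition spc_handlebody (R : realType) (n : nat) (K E : set (Cn R n)) :
    Prop :=
  [/\ closed_spc_domain K, E `<=` K & strong_deformation_retract R K E].

(* Coordinates zeta = (z, w), z = x + iy in C^k, w = u + iv in C^m, on
   C^(k + m); thus n = k + m. *)
Section Quadric.
Variables (R : realType) (k m : nat).
Implicit Type zeta : Cn R (k + m).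

Definition xpart zeta : 'rV[R]_k := lsubmx zeta.1.
Definition ypart zeta : 'rV[R]_k := lsubmx zeta.2.
Definition upart zeta : 'rV[R]_m := rsubmx zeta.1.
Definition vpart zeta : 'rV[R]_m := rsubmx zeta.2.

Definition xsq zeta : R := dot (xpart zeta) (xpart zeta).

Definition Lambda : set (Cn R (k + m)) :=
  [set zeta | [/\ ypart zeta = 0, upart zeta = 0 & vpart zeta = 0]].

Variables (A : 'M[R]_k) (B : 'M[R]_m).

Definition Qform zeta : R :=
  dot (ypart zeta *m A^T) (ypart zeta) + dot (vpart zeta *m B^T) (vpart zeta)
  + dot (upart zeta) (upart zeta).

Definition rho zeta : R := Qform zeta - xsq zeta.

Definition tau (h : R -> R) zeta : R := Qform zeta - h (xsq zeta).

End Quadric.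

Arguments Lambda {R k m}.

(* Main.v *)
Require Import Defs.
From HB Require Import structures.
From mathcomp Require Import all_boot all_order all_algebra.
From mathcomp Require Import complex.
From mathcomp Require Import all_classical all_reals all_analysis.
From mathcomp Require Import ring lra.

(** Write eta = (y, u, v) for the coordinates transverse to Lambda, and
    s = |x|^2.  Both K = {tau <= c} and E = {rho <= c - c0} u Lambda are
    described in the (s, Q)-plane: K is Q <= h(s) + c, and E is
    Q <= s + (c - c0) together with the axis Q = 0.  Since Q is homogeneous of
    degree 2 in eta, every fibre x = const of K is star-shaped about Lambda,
    and the theorem follows from scaling eta in these fibres.

    - Deformation retraction ([quadric_retract]).  Scaling eta by
      min(1, max(s + (c - c0), 0) / Q) retracts C^n onto E, and the straight
      line homotopy to this map stays in any fibrewise star-shaped set.  The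
      ratio may jump on Lambda, but it lies in [0, 1] and multiplies a
      vector that vanishes there, so the map is continuous.

    - Pseudoconvexity ([closed_spc_domain_sublevel]).  The defining function
      is tau - c.  Its Levi form is that of tau, and its derivative along eta
      is 2 Q, which is positive on {tau = c} because there Q = h(s) + c > 0;
      hence c is a regular value and the topological frontier is the level
      set.  Smoothness of all orders comes from closure of the classes C^j
      under sums, products and composition with functions of one variable.

    - Position of K.  The pairs (s, Q) fill the closed quadrant
      ([exists_xsq_Qform]), so (iii) is a statement about h: it gives
      h(s) >= s - c0, whence E is in K, and max(s - r - h(s), eps - h(s)) > 0
      for all s >= 0.  This maximum is bounded below by a constant c1 > 0
      ([profile_uniform]): by compactness on [0, R0], and by c0 - r beyond R0.
      For c < c1, a point of K satisfies Q < s - r or Q < eps. *)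

Set Implicit Arguments.
Unset Strict Implicit.
Unset Printing Implicit Defensive.

Import Order.TTheory GRing.Theory Num.Theory.
Import numFieldNormedType.Exports.

Local Open Scope classical_set_scope.
Local Open Scope ring_scope.

(** * Functions of class C^j *)

Section Smooth.
Variables (R : realType) (V : normedModType R).
Implicit Types (f g : V -> R) (j : nat).

Lemma CkW j f : Ck j.+1 setT f -> Ck j setT f.
Proof.
elim: j f => [|j IH] f [df Df].
  by move=> p _; exact: differentiable_continuous (df p I).
by split=> // v; exact: IH (Df v).
Qed.

Lemma Ck_cst j (a : R) : Ck j (setT : set V) (fun _ => a).
Proof.
elim: j a => [|j IH] a /=; first by move=> p _; exact: cst_continuous.
split=> [p _|v]; first exact: differentiable_cst.
suff -> : 'D_v (fun _ : V => a) = (fun _ => 0) by exact: IH.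
by apply/funext => p; rewrite derive_cst.
Qed.

Lemma Ck_add j f g :
  Ck j setT f -> Ck j setT g -> Ck j setT (fun p => f p + g p).
Proof.
elim: j f g => [|j IH] f g.
  by move=> cf cg p _; apply: continuousD; [exact: cf | exact: cg].
move=> [df Df] [dg Dg]; split=> [p _|v].
  exact: differentiableD (df p I) (dg p I).
suff -> : 'D_v (fun p => f p + g p) = fun p => 'D_v f p + 'D_v g p.
  by apply: IH; [exact: Df | exact: Dg].
apply/funext => p.
exact: deriveD (diff_derivable (df p I)) (diff_derivable (dg p I)).
Qed.

Lemma Ck_mul j f g :
  Ck j setT f -> Ck j setT g -> Ck j setT (fun p => f p * g p).
Proof.
elim: j f g => [|j IH] f g.
  by move=> cf cg p _; apply: continuousM; [exact: cf | exact: cg].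
move=> Cf Cg; have [df Df] := Cf; have [dg Dg] := Cg; split=> [p _|v].
  exact: differentiableM (df p I) (dg p I).
suff -> : 'D_v (fun p => f p * g p) =
    fun p => f p * 'D_v g p + g p * 'D_v f p.
  by apply: Ck_add; apply: IH; [exact: CkW | exact: Dg | exact: CkW | exact: Df].
apply/funext => p.
exact: deriveM (diff_derivable (df p I)) (diff_derivable (dg p I)).
Qed.

(** The chain rule in the form needed to iterate: the factor on the right is
    again a function of one variable composed with f. *)
Lemma derive_compR (g : R -> R) f (v p : V) :
  differentiable f p -> differentiable (g : R^o -> R) (f p) ->
  'D_v (fun q => g (f q)) p = 'D_v f p * 'D_(1 : R^o) (g : R^o -> R) (f p).
Proof.
move=> df dg.
have dfg : differentiable ((g : R^o -> R) \o (f : V -> R^o)) p.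
  exact: differentiable_comp.
rewrite (deriveE _ dfg) (deriveE _ df) (deriveE _ dg) diff_comp //=.
rewrite -[X in 'd g _ X]/('d f p v) -[X in 'd g _ X]mulr1.
by rewrite -[LHS]/('d (g : R^o -> R) (f p) ('d f p v *: (1:R^o))) linearZ.
Qed.

(** By induction on j: D_v (g o f) = D_v f * (g' o f), where D_v f and g' are
    one order less smooth and f is still a valid inner function. *)
Lemma Ck_comp j (g : R -> R) f :
  Ck j (setT : set R^o) g -> Ck j setT f -> Ck j setT (fun p => g (f p)).
Proof.
elim: j g f => [|j IH] g f.
  move=> cg cf p _; apply: (@continuous_comp _ _ _ f g); first exact: cf.
  exact: cg.
move=> Cg Cf; have [dg Dg] := Cg; have [df Df] := Cf; split=> [p _|v].
  exact: (@differentiable_comp _ V R^o R f g p (df p I) (dg (f p) I)).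
suff -> : 'D_v (fun p => g (f p)) =
    fun p => 'D_v f p * 'D_(1 : R^o) (g : R^o -> R) (f p).
  apply: Ck_mul; first exact: Df.
  exact: (IH ('D_(1 : R^o) (g : R^o -> R)) f (Dg 1) (CkW Cf)).
by apply/funext => p; apply: derive_compR; [exact: df | exact: dg].
Qed.

Lemma Ck_linear j (f : {linear V -> R}) : continuous f -> Ck j setT f.
Proof.
move=> cf; case: j => [|j] /=; first by move=> p _; exact: cf.
split=> [p _|v]; first exact: linear_differentiable.
suff -> : 'D_v f = (fun _ => f v) by exact: Ck_cst.
apply/funext => p; rewrite deriveE; last exact: linear_differentiable.
by rewrite diff_lin.
Qed.

Lemma Ck_sum j (I : Type) (s : seq I) (F : I -> V -> R) :
  (forall i, Ck j setT (F i)) -> Ck j setT (fun p => \sum_(i <- s) F i p).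
Proof.
move=> CF; elim: s => [|i s IH].
  under eq_fun do rewrite big_nil; exact: Ck_cst.
under eq_fun do rewrite big_cons; exact: Ck_add.
Qed.

Lemma Ck_dot j n (a b : V -> 'rV[R]_n) :
  (forall i, Ck j setT (fun p => a p 0 i)) ->
  (forall i, Ck j setT (fun p => b p 0 i)) ->
  Ck j setT (fun p => dot (a p) (b p)).
Proof. by move=> Ca Cb; apply: Ck_sum => i; exact: Ck_mul. Qed.

Lemma Ck_mulmx j n l (a : V -> 'rV[R]_n) (M : 'M[R]_(n, l)) :
  (forall i, Ck j setT (fun p => a p 0 i)) ->
  forall i, Ck j setT (fun p => (a p *m M) 0 i).
Proof.
move=> Ca i; under eq_fun do rewrite mxE.
by apply: Ck_sum => t; apply: Ck_mul => //; exact: Ck_cst.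
Qed.

End Smooth.

(** * Coordinates and the Levi form *)

Section Coordinates.
Variables (R : realType) (n : nat).

Lemma Ck_re j (i : 'I_n) : Ck j setT (fun p : Cn R n => p.1 0 i).
Proof.
pose f (p : Cn R n) : R := p.1 0 i.
have lf : linear f by move=> a p q; rewrite /f /= !mxE.
pose L : {linear Cn R n -> R} :=
  HB.pack f (GRing.isLinear.Build R (Cn R n) R _ f lf).
apply: (@Ck_linear _ _ j L) => p.
apply: (@continuous_comp _ _ _ fst (fun M : 'rV[R]_n => M 0 i)).
  exact: cvg_fst.
exact: coord_continuous.
Qed.

Lemma Ck_im j (i : 'I_n) : Ck j setT (fun p : Cn R n => p.2 0 i).
Proof.
pose f (p : Cn R n) : R := p.2 0 i.
have lf : linear f by move=> a p q; rewrite /f /= !mxE.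
pose L : {linear Cn R n -> R} :=
  HB.pack f (GRing.isLinear.Build R (Cn R n) R _ f lf).
apply: (@Ck_linear _ _ j L) => p.
apply: (@continuous_comp _ _ _ snd (fun M : 'rV[R]_n => M 0 i)).
  exact: cvg_snd.
exact: coord_continuous.
Qed.

Local Open Scope complex_scope.

Lemma levi_subC (phi : Cn R n -> R) (c : R) p v :
  (forall q, differentiable phi q) ->
  levi (fun q => phi q - c) p v = levi phi p v.
Proof.
move=> dphi; rewrite /levi.
have E l : dzetabar l (fun q => (phi q - c)%:C) =
           dzetabar l (fun q => (phi q)%:C).
  have D w q : 'D_w (fun q => phi q - c) q = 'D_w phi q.
    rewrite (deriveB (diff_derivable (dphi q)) (derivable_cst _ _ _)).
    by rewrite derive_cst subr0.
  by apply/funext => q; rewrite /dzetabar /cderive /= !D.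
by apply: eq_bigr => i _; apply: eq_bigr => l _; rewrite E.
Qed.

Lemma strongly_psh_subC (phi : Cn R n -> R) (c : R) :
  strongly_psh setT phi -> strongly_psh setT (fun q => phi q - c).
Proof.
move=> [C2 L]; split; first exact: (Ck_add C2 (Ck_cst _ 2 (- c))).
move=> p _ v v0; rewrite levi_subC; first exact: L.
by move=> q; case: C2 => d _; exact: d.
Qed.

End Coordinates.

(** * Sublevel sets of regular values *)

Section Sublevel.
Variables (R : realType) (n : nat) (phi : Cn R n -> R).

(** A zero interior to the sublevel set would be a local maximum of phi, which
    contradicts a nonzero differential; the other inclusions are continuity. *)
Lemma frontier_sublevel :
  (forall p, differentiable phi p) ->
  (forall p, phi p = 0 -> exists v, 'd phi p v != 0) ->
  frontier [set p | phi p <= 0] = [set p | phi p = 0].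
Proof.
move=> dphi reg.
have cphi : continuous phi by move=> p; exact: differentiable_continuous.
have Kcl : closed [set p | phi p <= 0].
  by apply: (@preimage_closed _ _ phi [set x : R | x <= 0]);
    [move=> p _; exact: cphi | exact: closed_le].
rewrite /frontier -((closure_id [set p | phi p <= 0]).1 Kcl).
apply/seteqP; split=> p /=.
  move=> [p_le0 not_int]; apply/eqP; rewrite eq_le p_le0 /= leNgt.
  apply/negP => p_lt0; apply: not_int; rewrite /interior /=.
  have /cvgr_lt := cphi p; move=> /(_ 0 p_lt0).
  by apply: filterS => q /ltW.
move=> p0; split; first by rewrite p0.
rewrite /interior /= => p_int.
(* Moving from p in a direction of increase leaves the sublevel set. *)
have key v : 0 < 'd phi p v -> False.
  rewrite -deriveE // => Dv0.
  have dv := diff_derivable (dphi p) (v := v).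
  have dv' : t^-1 *: ((phi \o shift p) (t *: v) - phi p)
     @[t --> 0^'+] --> 'D_v phi p by exact: cvg_dnbhs_at_right dv.
  have posq := cvgr_gt _ dv' _ Dv0.
  have cline : (fun t : R => t *: v + p) t @[t --> 0] --> p.
    rewrite -[X in _ --> X]add0r -(scale0r v).
    by apply: cvgD; [apply: cvgZr_tmp; exact: cvg_id | exact: cvg_cst].
  have Kline : \forall t \near (0 : R)^'+, phi (t *: v + p) <= 0.
    by apply: cvg_within; exact: (cline _ p_int).
  near (0 : R)^'+ => t.
  have t0 : 0 < t by near: t; exact: nbhs_right_gt.
  have : phi (t *: v + p) <= 0 by near: t; exact: Kline.
  have : 0 < t^-1 *: ((phi \o shift p) (t *: v) - phi p).
    by near: t; exact: posq.
  rewrite /= p0 subr0 -[_ *: _]/(t^-1 * phi (t *: v + p)).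
  rewrite pmulr_rgt0 ?invr_gt0 // => lt0 le0.
  by have := lt_le_trans lt0 le0; rewrite ltxx.
have [v] := reg p p0; case: ltgtP => // dv _; last exact: key dv.
by apply: (key (- v)); rewrite linearN oppr_gt0.
Unshelve. all: by end_near.
Qed.

Lemma closed_spc_domain_sublevel :
  smooth setT phi -> strongly_psh setT phi ->
  (forall p, phi p = 0 -> exists v, 'd phi p v != 0) ->
  closed_spc_domain [set p | phi p <= 0].
Proof.
move=> sphi psh reg.
have dphi p : differentiable phi p by case: (sphi 1%N) => d _; exact: d.
have front := frontier_sublevel dphi reg.
split.
  apply: (@preimage_closed _ _ phi [set x : R | x <= 0]); last exact: closed_le.
  by move=> p _; exact: differentiable_continuous.
exists setT, phi; split => //.
- by split => //; exact: openT.
- by apply/seteqP; split => p //= [].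
- by rewrite front; apply/seteqP; split => p //= [].
- by rewrite front.
Qed.

End Sublevel.

(** * Positive definite forms *)

Section Dot.
Variables (R : realType) (n : nat).
Implicit Types (a b : 'rV[R]_n) (M : 'M[R]_n).

Lemma dotZZ (c d : R) a b : dot (c *: a) (d *: b) = c * d * dot a b.
Proof.
by rewrite /dot big_distrr; apply: eq_bigr => i _; rewrite !mxE mulrACA.
Qed.

Lemma dot_ge0 a : 0 <= dot a a.
Proof. by apply: sumr_ge0 => i _; rewrite -expr2 sqr_ge0. Qed.

Lemma dot_eq0 a : dot a a = 0 -> a = 0.
Proof.
move=> /eqP; rewrite psumr_eq0; last by move=> i _; rewrite -expr2 sqr_ge0.
move=> /allP a0; apply/rowP => i; rewrite mxE; apply/eqP.
by have := a0 i (mem_index_enum _); rewrite /= mulf_eq0 orbb.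
Qed.

Lemma posdef_ge0 M a : posdef M -> 0 <= dot (a *m M^T) a.
Proof.
move=> Mp; have [->|a0] := eqVneq a 0; last exact/ltW/Mp.
by rewrite /dot big1 // => i _; rewrite [X in _ * X]mxE mulr0.
Qed.

Lemma posdef_eq0 M a : posdef M -> dot (a *m M^T) a = 0 -> a = 0.
Proof.
by move=> Mp Ma; apply: contra_eq Ma => a0; rewrite gt_eqF // Mp.
Qed.

Lemma posdef_of_sub1 M : posdef (M - 1%:M) -> posdef M.
Proof.
move=> Mp a a0; apply: (lt_le_trans (Mp a a0)).
rewrite -subr_ge0; suff -> : dot (a *m M^T) a - dot (a *m (M - 1%:M)^T) a =
  dot a a by exact: dot_ge0.
rewrite /dot -sumrB; apply: eq_bigr => i _; rewrite linearB /= trmx1.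
by rewrite mulmxBr mulmx1 !mxE; ring.
Qed.

End Dot.

(** * Scaling in the fibres over the x-space *)

Section Fiber.
Variables (R : realType) (k m : nat).
Implicit Types (zeta : Cn R (k + m)) (mu : R).

(** The radial vector field (0, eta) of the fibres over the x-space. *)
Definition fiber zeta : Cn R (k + m) := (row_mx 0 (upart zeta), zeta.2).

Definition scale_fiber mu zeta := zeta + (mu - 1) *: fiber zeta.

Lemma xpart_scale mu zeta : xpart (scale_fiber mu zeta) = xpart zeta.
Proof.
by rewrite /xpart /= linearD linearZ /= row_mxKl scaler0 addr0.
Qed.

Lemma upart_scale mu zeta : upart (scale_fiber mu zeta) = mu *: upart zeta.
Proof.
rewrite /upart /= linearD linearZ /= row_mxKr scalerBl scale1r.
by rewrite addrC subrK.
Qed.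

Lemma im_scale mu zeta : (scale_fiber mu zeta).2 = mu *: zeta.2.
Proof. by apply/rowP => i; rewrite !mxE; ring. Qed.

Lemma ypart_scale mu zeta : ypart (scale_fiber mu zeta) = mu *: ypart zeta.
Proof. by rewrite /ypart im_scale; apply/rowP => i; rewrite !mxE. Qed.

Lemma vpart_scale mu zeta : vpart (scale_fiber mu zeta) = mu *: vpart zeta.
Proof. by rewrite /vpart im_scale; apply/rowP => i; rewrite !mxE. Qed.

Lemma scale1_fiber zeta : scale_fiber 1 zeta = zeta.
Proof. by rewrite /scale_fiber subrr scale0r addr0. Qed.

Lemma xsq_scale mu zeta : xsq (scale_fiber mu zeta) = xsq zeta.
Proof. by rewrite /xsq xpart_scale. Qed.

Lemma xsq_ge0 zeta : 0 <= xsq zeta. Proof. exact: dot_ge0. Qed.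

Lemma scale_fiber0_Lambda zeta : Lambda (scale_fiber 0 zeta).
Proof. by split; rewrite ?ypart_scale ?upart_scale ?vpart_scale scale0r. Qed.

Lemma fiber_Lambda zeta : Lambda zeta -> fiber zeta = 0.
Proof.
case=> y0 u0 v0; rewrite /fiber u0 row_mx0; congr pair.
by rewrite -(hsubmxK zeta.2) -/(ypart zeta) -/(vpart zeta) y0 v0 row_mx0.
Qed.

(** A linear map: it is written out on the standard basis, where only scalar
    coordinates vary. *)
Lemma continuous_fiber : continuous fiber.
Proof.
have -> : fiber = fun zeta =>
    \sum_(i < m) zeta.1 0 (rshift k i) *:
      ((delta_mx 0 (rshift k i), 0) : Cn R (k + m))
    + \sum_(i < k + m) zeta.2 0 i *: ((0, delta_mx 0 i) : Cn R (k + m)).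
  apply/funext => zeta.
  have s1 (I : Type) (s : seq I) (F : I -> Cn R (k + m)) :
      (\sum_(i <- s) F i) = (\sum_(i <- s) (F i).1, \sum_(i <- s) (F i).2).
    by elim/big_rec3: _ => [//|i a b c _ ->].
  rewrite !s1 /=; congr pair.
    rewrite [X in _ + X]big1 ?addr0; last by move=> i _; rewrite scaler0.
    rewrite [LHS]row_sum_delta big_split_ord /= big1 ?add0r => [|i _].
      by apply: eq_bigr => i _; rewrite row_mxEr mxE.
    by rewrite row_mxEl mxE scale0r.
  rewrite /= [X in X + _]big1 ?add0r; last by move=> i _; rewrite scaler0.
  exact: row_sum_delta.
have csum n (F : 'I_n -> Cn R (k + m) -> R) (w : 'I_n -> Cn R (k + m)) :
    (forall i, Ck 0 setT (F i)) ->
    continuous (fun zeta => \sum_i F i zeta *: w i).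
  move=> cF p.
  rewrite /continuous_at; elim: (index_enum _) => [|i s IH].
    by under eq_fun do rewrite big_nil; rewrite big_nil; exact: cvg_cst.
  under eq_fun do rewrite big_cons; rewrite big_cons; apply: cvgD => //.
  by apply: cvgZr_tmp; exact: cF.
move=> p; apply: cvgD; apply: csum => i; [exact: Ck_re | exact: Ck_im].
Qed.

Lemma Ck_xsq j : Ck j setT (@xsq R k m).
Proof.
by apply: Ck_dot => i; under eq_fun do rewrite mxE; exact: Ck_re.
Qed.

Variables (A : 'M[R]_k) (B : 'M[R]_m).

Lemma Ck_Qform j : Ck j setT (Qform A B).
Proof.
apply: Ck_add; first apply: Ck_add.
- by apply: Ck_dot; first apply: Ck_mulmx; move=> i;
    under eq_fun do rewrite mxE; exact: Ck_im.
- by apply: Ck_dot; first apply: Ck_mulmx; move=> i;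
    under eq_fun do rewrite mxE; exact: Ck_im.
- by apply: Ck_dot => i; under eq_fun do rewrite mxE; exact: Ck_re.
Qed.

Lemma Qform_scale mu zeta :
  Qform A B (scale_fiber mu zeta) = mu ^+ 2 * Qform A B zeta.
Proof.
rewrite /Qform ypart_scale upart_scale vpart_scale -!scalemxAl !dotZZ.
by rewrite !mulrDr expr2.
Qed.

Hypotheses (A_pos : posdef A) (B_pos : posdef B).

Lemma Qform_ge0 zeta : 0 <= Qform A B zeta.
Proof. by rewrite !addr_ge0 ?posdef_ge0 ?dot_ge0. Qed.

Lemma Qform_eq0 zeta : Qform A B zeta = 0 -> Lambda zeta.
Proof.
have y_ge0 := posdef_ge0 (ypart zeta) A_pos.
have v_ge0 := posdef_ge0 (vpart zeta) B_pos.
have u_ge0 := dot_ge0 (upart zeta).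
rewrite /Qform => Q0; split.
- by apply: (posdef_eq0 A_pos); lra.
- by apply: dot_eq0; lra.
- by apply: (posdef_eq0 B_pos); lra.
Qed.

Lemma Qform_Lambda zeta : Lambda zeta -> Qform A B zeta = 0.
Proof.
case=> y0 u0 v0; rewrite /Qform y0 u0 v0 !mul0mx.
have d0 n : dot (0 : 'rV[R]_n) 0 = 0.
  by rewrite /dot big1 // => i _; rewrite mxE mul0r.
by rewrite !d0 !addr0.
Qed.

(** The factor by which eta is multiplied to land in the set where
    Q <= max(s + b, 0).  It is the square of the factor that would reach the
    boundary of that set exactly: this avoids a square root, and overshooting
    is harmless since only points outside the set are moved.  When Q = 0 the
    quotient is 0 and the factor acts on the zero vector. *)
Definition fiber_ratio b zeta : R :=
  Num.min 1 (Num.max (xsq zeta + b) 0 / Qform A B zeta).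

Lemma fiber_ratio_ge0 b zeta : 0 <= fiber_ratio b zeta.
Proof.
by rewrite le_min ler01 divr_ge0 ?Qform_ge0 // le_max lexx orbT.
Qed.

Lemma fiber_ratio_le1 b zeta : fiber_ratio b zeta <= 1.
Proof. by rewrite ge_min lexx. Qed.

(** The ratio itself may jump at Q = 0, but there the fibre vector vanishes and
    the bound 0 <= ratio <= 1 gives continuity of the product. *)
Lemma continuous_ratio_fiber b :
  continuous (fun zeta => fiber_ratio b zeta *: fiber zeta).
Proof.
move=> p; have [Q0|Q0] := eqVneq (Qform A B p) 0.
  have Np : fiber p = 0 by exact/fiber_Lambda/Qform_eq0.
  rewrite /continuous_at Np scaler0; apply: norm_cvg0.
  apply: (@squeeze_cvgr _ _ _ _ (fun _ => 0) (fun q => `|fiber q|)).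
  - apply: nearW => q; rewrite normr_ge0 /= normrZ ger0_norm ?fiber_ratio_ge0 //.
    by rewrite ler_piMl ?fiber_ratio_le1.
  - exact: cvg_cst.
  - rewrite -(normr0 (Cn R (k + m))) -Np; apply: cvg_norm.
    exact: continuous_fiber.
apply: cvgZ; last exact: continuous_fiber.
apply: (@continuous_min _ _ (fun _ => 1)
  (fun q => Num.max (xsq q + b) 0 / Qform A B q)); first exact: cvg_cst.
apply: cvgM.
  apply: (@continuous_max _ _ (fun q => xsq q + b) (fun _ => 0)).
    by apply: cvgD; [exact: (Ck_xsq 0) | exact: cvg_cst].
  exact: cvg_cst.
by apply: cvgV => //; exact: (Ck_Qform 0).
Qed.

(** The homotopy scales eta along the segment from 1 to the ratio.  At time 1,
    if 0 <= s + b then ratio^2 Q <= ratio Q <= s + b; if s + b < 0 the ratio is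
    0 and the point lands on Lambda. *)
Lemma quadric_retract (K : set (Cn R (k + m))) b :
  let E := [set zeta | rho A B zeta <= b] `|` Lambda in
  E `<=` K ->
  (forall zeta mu, K zeta -> 0 <= mu <= 1 -> K (scale_fiber mu zeta)) ->
  strong_deformation_retract R K E.
Proof.
move=> E EK star; split => //.
pose lam := fiber_ratio b.
exists (fun pt => scale_fiber (1 - pt.2 + pt.2 * lam pt.1) pt.1).
have mu01 p t : 0 <= t <= 1 -> 0 <= 1 - t + t * lam p <= 1.
  have := fiber_ratio_ge0 b p; have := fiber_ratio_le1 b p; rewrite -/(lam p).
  by move=> l1 l0 /andP[t0 t1]; apply/andP; split; nra.
split=> /=.
- apply: continuous_subspaceT => pt.
  rewrite (_ : (fun _ => _) = fun pt : Cn R (k + m) * R =>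
    pt.1 + pt.2 *: (lam pt.1 *: fiber pt.1 - fiber pt.1)); last first.
    apply/funext => -[p t] /=; rewrite /scale_fiber; congr (_ + _).
    rewrite -[X in _ *: (_ - X)]scale1r -scalerBl scalerA; congr (_ *: _).
    ring.
  apply: cvgD; first exact: cvg_fst.
  apply: cvgZ; first exact: cvg_snd.
  apply: (@continuous_comp _ _ _ fst
    (fun p => lam p *: fiber p - fiber p)); first exact: cvg_fst.
  by apply: cvgB; [exact: continuous_ratio_fiber | exact: continuous_fiber].
- by move=> p t Kp t01; apply: star => //; exact: mu01.
- by move=> p _; rewrite subr0 mul0r addr0 scale1_fiber.
- move=> p _; rewrite subrr add0r mul1r.
  have Qp := Qform_ge0 p; have [Q0|Qn0] := eqVneq (Qform A B p) 0.
    by right; apply: Qform_eq0; rewrite Qform_scale Q0 mulr0.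
  have [sb|sb] := leP 0 (xsq p + b); last first.
    have -> : lam p = 0.
      by rewrite /lam /fiber_ratio (max_idPr (ltW sb)) mul0r (min_idPr ler01).
    by right; exact: scale_fiber0_Lambda.
  left; rewrite /= /rho Qform_scale xsq_scale.
  have lamQ : lam p * Qform A B p <= xsq p + b.
    rewrite -ler_pdivlMr ?lt_def ?Qn0 //.
    by rewrite /lam /fiber_ratio (max_idPl sb) ge_min lexx orbT.
  have := fiber_ratio_ge0 b p; have := fiber_ratio_le1 b p; rewrite -/(lam p).
  nra.
- move=> p t Ep _; have [Q0|Qn0] := eqVneq (Qform A B p) 0.
    by rewrite /scale_fiber (fiber_Lambda (Qform_eq0 Q0)) scaler0 addr0.
  have Qgt0 : 0 < Qform A B p by rewrite lt_def Qn0 Qform_ge0.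
  have Qle : Qform A B p <= xsq p + b.
    case: Ep => [/=|/Qform_Lambda Q0]; first by rewrite /rho; lra.
    by rewrite Q0 eqxx in Qn0.
  have -> : lam p = 1.
    rewrite /lam /fiber_ratio (max_idPl (le_trans (ltW Qgt0) Qle)).
    by apply/min_idPl; rewrite ler_pdivlMr // mul1r.
  by rewrite mulr1 subrK scale1_fiber.
Qed.

(** Allows inequalities between sets in C^n to be read as inequalities between
    functions of s, by choosing Q at will over each s. *)
Lemma exists_xsq_Qform (s q : R) : (0 < k)%N -> 0 <= s -> 0 <= q ->
  exists zeta, xsq zeta = s /\ Qform A B zeta = q.
Proof.
move=> k_gt0 s0 q0; pose e : 'rV[R]_k := delta_mx 0 (Ordinal k_gt0).
have e0 : e != 0.
  apply/eqP => /rowP/(_ (Ordinal k_gt0)) /eqP.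
  by rewrite !mxE !eqxx oner_eq0.
have ee : dot e e = 1.
  rewrite /dot (bigD1 (Ordinal k_gt0)) //= big1 => [|i ni].
    by rewrite !mxE !eqxx mulr1 addr0.
  by rewrite !mxE (negPf ni) mulr0.
pose a := dot (e *m A^T) e; have a0 : 0 < a by exact: A_pos.
pose zeta : Cn R (k + m) :=
  (row_mx (Num.sqrt s *: e) 0, row_mx (Num.sqrt (q / a) *: e) 0).
have dot0 n (b : 'rV[R]_n) : dot b 0 = 0.
  by rewrite /dot big1 // => i _; rewrite mxE mulr0.
exists zeta; split.
  by rewrite /xsq /xpart row_mxKl dotZZ ee mulr1 -expr2 sqr_sqrtr.
rewrite /Qform /ypart /vpart /upart !row_mxKr row_mxKl !dot0 !addr0.
rewrite -scalemxAl dotZZ -expr2 sqr_sqrtr ?divr_ge0 ?(ltW a0) //.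
by rewrite divfK // gt_eqF.
Qed.

(** Euler's relation: along eta, |x|^2 is constant and Q is quadratic. *)
Lemma derive_tau_fiber (g : R -> R) zeta :
  'D_(fiber zeta) (fun q => Qform A B q - g (xsq q)) zeta =
  2 * Qform A B zeta.
Proof.
rewrite /derive; apply: cvg_lim => //.
set q := Qform A B zeta.
have near2 : (2 + t) * q @[t --> (0 : R)^'] --> 2 * q.
  rewrite -[X in _ --> X * q]addr0; apply: cvgMr_tmp; apply: cvgD.
    exact: cvg_cst.
  exact: cvg_within.
apply: cvg_trans near2; apply: near_eq_cvg.
near=> t.
have t0 : t != 0 by near: t; exact: nbhs_dnbhs_neq.
have E : t *: fiber zeta + zeta = scale_fiber (1 + t) zeta.
  by rewrite /scale_fiber addrC [1 + t]addrC addrK.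
rewrite /= E Qform_scale xsq_scale -/q -[RHS]/(_ * _).
field.
exact: t0.
Unshelve. all: by end_near. Qed.

End Fiber.

(** * The profile function h *)

Section Profile.
Variables (R : realType) (k m : nat) (k_gt0 : (0 < k)%N).
Variables (A : 'M[R]_k) (B : 'M[R]_m).
Hypotheses (A_pos : posdef A) (B_pos : posdef B).
Variable h : R -> R.
Hypothesis h_ge0 : forall t, 0 <= t -> 0 <= h t.

(** For s >= c0, test the inclusion at a point with Q = s - c0; for s < c0 the
    bound is h >= 0. *)
Lemma profile_ge c0 :
  [set zeta | rho A B zeta <= - c0] `<=` [set zeta | tau A B h zeta <= 0] ->
  forall s, 0 <= s -> s - c0 <= h s.
Proof.
move=> sub s s0; have [sc|sc] := leP 0 (s - c0); last first.
  exact: le_trans (ltW sc) (h_ge0 s0).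
have [z [xz Qz]] := exists_xsq_Qform B A_pos k_gt0 s0 sc.
have : rho A B z <= - c0 by rewrite /rho xz Qz; lra.
by move=> /sub /=; rewrite /tau xz Qz subr_le0.
Qed.

(** Test the inclusion at a point with Q = h(s), on the boundary of
    {tau <= 0}. *)
Lemma profile_alternative r eps :
  [set zeta | tau A B h zeta <= 0] `<=`
    [set zeta | rho A B zeta < - r] `|` [set zeta | Qform A B zeta < eps] ->
  forall s, 0 <= s -> 0 < Num.max (s - r - h s) (eps - h s).
Proof.
move=> sub s s0.
have [z [xz Qz]] := exists_xsq_Qform B A_pos k_gt0 s0 (h_ge0 s0).
have : tau A B h z <= 0 by rewrite /tau xz Qz subrr.
rewrite lt_max => /sub [] /=; rewrite /rho ?xz Qz => ?; apply/orP.
  by left; lra.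
by right; lra.
Qed.

(** The margin by which the inclusion of {tau <= 0} can be relaxed: compactness
    gives it for s in [0, R0], and for s >= R0 the first entry is c0 - r. *)
Lemma profile_uniform (g : R -> R) r eps c0 R0 :
  continuous g -> {in `[0, +oo[, h =1 g} -> 0 <= R0 ->
  (forall s, R0 <= s -> h s = s - c0) -> r < c0 ->
  (forall s, 0 <= s -> 0 < Num.max (s - r - h s) (eps - h s)) ->
  exists2 c1, 0 < c1 &
    forall s, 0 <= s -> c1 <= Num.max (s - r - h s) (eps - h s).
Proof.
move=> cg hg R00 hR rc0 alt.
pose f s := Num.max (s - r - g s) (eps - g s).
have fE s : 0 <= s -> Num.max (s - r - h s) (eps - h s) = f s.
  by move=> s0; rewrite /f hg // in_itv /= s0.
have cf : continuous f.
  move=> s; apply: (@continuous_max _ _ (fun s => s - r - g s)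
    (fun s => eps - g s)).
    apply: cvgB; last exact: cg.
    by apply: cvgB; [exact: cvg_id | exact: cvg_cst].
  by apply: cvgB; [exact: cvg_cst | exact: cg].
have [s0 s0in minf] := EVT_min R00 (continuous_subspaceT cf).
have s0_ge0 : 0 <= s0 by move: s0in; rewrite in_itv /= => /andP[].
have fs0 : 0 < f s0 by rewrite -fE ?alt.
exists (Num.min (f s0) (c0 - r)) => [|s s_ge0].
  by rewrite lt_min fs0 subr_gt0.
have [sR|Rs] := leP s R0.
  by rewrite fE // ge_min minf // in_itv /= s_ge0.
apply: (@le_trans _ _ (c0 - r)); first by rewrite ge_min lexx orbT.
by rewrite le_max hR ?(ltW Rs) //; apply/orP; left; lra.
Qed.

(** On {tau = c} the derivative of tau along eta is 2 Q = 2 (h(s) + c) > 0. *)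
Lemma closed_spc_domain_tau (g : R -> R) c :
  smooth (setT : set R^o) g -> {in `[0, +oo[, h =1 g} ->
  strongly_psh setT (tau A B h) -> 0 < c ->
  closed_spc_domain [set zeta | tau A B h zeta <= c].
Proof.
move=> gsm hg psh c0.
have tauE : tau A B h = fun zeta => Qform A B zeta - g (xsq zeta).
  by apply/funext => z; rewrite /tau hg // in_itv /= xsq_ge0.
have sm : smooth setT (tau A B h).
  rewrite tauE => j; apply: Ck_add; first exact: Ck_Qform.
  under eq_fun do rewrite -mulN1r.
  apply: Ck_mul; first exact: Ck_cst.
  by apply: Ck_comp; [exact: gsm | exact: Ck_xsq].
pose phi zeta := tau A B h zeta - c.
have dphi p : differentiable phi p.
  apply: differentiableB; last exact: differentiable_cst.
  by case: (sm 1%N) => d _; exact: d.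
suff -> : [set zeta | tau A B h zeta <= c] = [set zeta | phi zeta <= 0].
  apply: closed_spc_domain_sublevel.
  - by move=> j; apply: (Ck_add (sm j)); exact: Ck_cst.
  - exact: strongly_psh_subC.
  - move=> p p0; exists (fiber p); rewrite -deriveE //.
    (* The constant c is absorbed in the function of |x|^2. *)
    have phiE : phi = fun q => Qform A B q - (fun x => g x + c) (xsq q).
      by apply/funext => q; rewrite /phi tauE /=; lra.
    rewrite phiE (derive_tau_fiber A B (fun x => g x + c)) mulf_neq0 //.
    have := h_ge0 (xsq_ge0 p); move: p0; rewrite /phi /tau => p0 h0.
    by apply: lt0r_neq0; lra.
by apply/seteqP; split=> z /=; rewrite /phi subr_le0.
Qed.

Lemma spc_handlebody_tau (g : R -> R) c0 c :
  smooth (setT : set R^o) g -> {in `[0, +oo[, h =1 g} ->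
  strongly_psh setT (tau A B h) -> 0 < c ->
  (forall s, 0 <= s -> s - c0 <= h s) ->
  spc_handlebody [set zeta | tau A B h zeta <= c]
    ([set zeta | rho A B zeta <= c - c0] `|` Lambda).
Proof.
move=> gsm hg psh c_gt0 hge.
have EK : [set zeta | rho A B zeta <= c - c0] `|` Lambda `<=`
    [set zeta | tau A B h zeta <= c].
  move=> z [|/(Qform_Lambda A B) Q0] /=; rewrite /rho /tau.
    by have := hge _ (xsq_ge0 z); lra.
  by rewrite Q0; have := h_ge0 (xsq_ge0 z); lra.
split=> //; first exact: closed_spc_domain_tau hg psh c_gt0.
apply: quadric_retract => // z mu /=; rewrite /tau => Kz /andP[mu0 mu1].
rewrite Qform_scale xsq_scale; apply: le_trans Kz.
by rewrite lerD2r ler_piMl ?Qform_ge0 // exprn_ile1.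
Qed.

End Profile.

(** * Small sublevel sets of tau *)

Theorem corollary4p2 (R : realType) (k m : nat) (k_gt0 : (0 < k)%N)
    (A : 'M[R]_k) (B : 'M[R]_m)
    (A_sym : A^T = A) (B_sym : B^T = B)
    (A_pos : posdef (A - 1%:M)) (B_pos : posdef B)
    (r eps c0 R0 delta : R)
    (r_gt0 : 0 < r) (eps_gt0 : 0 < eps) (r_lt_c0 : r < c0) (c0_lt_R0 : c0 < R0)
    (delta_gt0 : 0 < delta)
    (h : R -> R)
    (h_ge0 : forall t, 0 <= t -> 0 <= h t)
    (h_smooth : smooth_on_nonneg h)
    (h_incr : {in `[0, +oo[ &, {homo h : s t / s < t}})
    (h_convex : convex_function (`[0, +oo[%classic : set (convex_lmodType R^o)) h)
    (tau_spsh : strongly_psh setT (tau A B h))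
    (tau_morse : morse_critical_point (tau A B h) 0 k)
    (tau_i : forall zeta, xsq zeta <= r ->
       tau A B h zeta = Qform A B zeta - delta * xsq zeta)
    (tau_ii : forall zeta, R0 <= xsq zeta ->
       tau A B h zeta = rho A B zeta + c0)
    (tau_iii : [set zeta | rho A B zeta <= - c0] `|` Lambda
                 `<=` [set zeta | tau A B h zeta <= 0] /\
               [set zeta | tau A B h zeta <= 0]
                 `<=` [set zeta | rho A B zeta < - r]
                      `|` [set zeta | Qform A B zeta < eps]) :
  \forall c \near (0 : R)^'+,
    let K := [set zeta | tau A B h zeta <= c] in
    let E := [set zeta | rho A B zeta <= c - c0] `|` Lambda in
    [/\ spc_handlebody K E,
        E `<=` K &
        K `<=` [set zeta | rho A B zeta < - r]
               `|` [set zeta | Qform A B zeta < eps]].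
Proof.
have A_pd := posdef_of_sub1 A_pos.
have [sub1 sub2] := tau_iii.
have [g gsm hg] := h_smooth.
have gcont : continuous g by move=> s; exact: (gsm 0).
have R0_ge0 : 0 <= R0 by lra.
have hR s : R0 <= s -> h s = s - c0.
  move=> Rs; have s_ge0 := le_trans R0_ge0 Rs.
  have [z [xz _]] := exists_xsq_Qform B A_pd k_gt0 s_ge0 (lexx 0).
  by have := tau_ii z; rewrite /tau /rho xz => /(_ Rs); lra.
have hge := profile_ge k_gt0 A_pd h_ge0 (fun z Ez => sub1 z (or_introl Ez)).
have [c1 c1_gt0 altc] := profile_uniform gcont hg R0_ge0 hR r_lt_c0
  (profile_alternative k_gt0 A_pd h_ge0 sub2).
near=> c.
have c_gt0 : 0 < c by near: c; exact: nbhs_right_gt.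
have c_lt : c < c1 by near: c; exact: nbhs_right_lt.
have KE := spc_handlebody_tau A_pd B_pos h_ge0 gsm hg tau_spsh c_gt0 hge.
split=> //; first by case: KE.
move=> z; rewrite /= /tau => Kz.
have := lt_le_trans c_lt (altc _ (xsq_ge0 z)).
by rewrite lt_max => /orP[?|?]; [left | right]; rewrite /= /rho; lra.
Unshelve. all: by end_near.
Qed.
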